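(* Let $V_t$ be a Markov semigroup on $E$ that is $\Lambda$-linked between $P_t$ and $Q^*_t$ with link $\lambda$. Fix $x^*_0\in D^*$ and let $\mathbb{V}_{\lambda(x^*_0,\cdot)}$ be a probability measure on $C(\mathbb{R}_+,E)$, with canonical process $(X^*(t),X(t))_{t\ge 0}$, satisfying for $0=t_0\le t_1<\cdots<t_N$ $$\mathbb{V}_{\lambda(x^*_0,\cdot)}\big((X^*(t_i),X(t_i))\in dx^*_i\times dx_i,\ i=1,\ldots,N\big)=\int\lambda(x^*_0,x_0)\,dx_0\,\prod_{i=1}^N V_{t_i-t_{i-1}}\big((x^*_{i-1},x_{i-1}),dx^*_i\times dx_i\big).$$ Then, under $\mathbb{V}_{\lambda(x^*_0,\cdot)}$, the process $X^*(t)$ is Markovian with initial state $X^*(0)=x^*_0$ and is governed by the Markov semigroup $Q^*_t$.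
   Context: Let $D=\mathbb{R}^n$ and let $D^*$ be a Polish space. Let $\gamma:\mathbb{R}^n\to\mathbb{R}$, $\nu=\exp(-2\gamma)$, $\beta=\nabla\gamma$ (assumed smooth enough), and let $P_t$ be the Markov semigroup on $D$ of the characteristic diffusion for $\nu$, i.e. the diffusion $dX(t)=-\beta(X(t))dt+dW(t)$ with generator $\mathcal{A}f=\sum_{i=1}^n[\frac12\partial_i^2 f-\beta_i\partial_i f]$. A link is a Markov kernel density $\lambda(x^*,x)$ from $D^*$ to $D$, i.e. $\lambda(x^*,\cdot)$ is a probability density on $D$ for each $x^*\in D^*$. Assume $E=\{(x^*,x)\in D^*\times D:\lambda(x^*,x)>0\}$ is Polish. Let $Q^*_t$ be a Markov semigroup on $D^*$ and $V_t$ a Markov semigroup on $E$. $V_t$ is said to be $\Lambda$-linked between $P_t$ and $Q^*_t$ if (a) $V_tf=P_tf$ whenever $f(x^*,x)=f(x)$ on $E$ depends on $x$ only; and (b) $\int\lambda(x^*,x)V_tg(x^*,x)\,dx=\int Q^*_t(x^*,dy^* )\int\lambda(y^*,y)g(y^*,y)\,dy$ for any $x^*\in D^*$ and any bounded measurable function $g$ on $E$. *)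

(* Defs.v *)
From HB Require Import structures.
From mathcomp Require Import all_boot all_order all_algebra.
From mathcomp Require Import all_classical all_reals all_analysis.
From mathcomp Require Import measurable_realfun.

Set Implicit Arguments.
Unset Strict Implicit.
Unset Printing Implicit Defensive.
Import Order.TTheory GRing.Theory Num.Theory numFieldNormedType.Exports.
Local Open Scope classical_set_scope.
Local Open Scope ring_scope.

Notation borel T := (g_sigma_algebraType (@open T)).

Section image_measure.
Context d1 d2 (T1 : measurableType d1) (T2 : measurableType d2) (R : realType).

Definition image_measure (m : set T1 -> \bar R) (f : {mfun T1 >-> T2}) :
  set T2 -> \bar R := pushforward m f.

HB.instance Definition _ (m : {measure set T1 -> \bar R}) f :=
  Measure.copy (image_measure m f)
    (measure_function_pushforward__canonical__measure_function_Measure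
       m (measurable_funPT f)).

Lemma image_measure_sigma_finite (m : set T1 -> \bar R)
    (f : {mfun T1 >-> T2}) (g : T2 -> T1) :
  measurable_fun setT g -> cancel f g ->
  sigma_finite setT m -> sigma_finite setT (image_measure m f).
Proof.
move=> mg fK [F FT Foo].
exists (fun k => g @^-1` F k); first by rewrite -preimage_bigcup -FT.
move=> k; have [mF Fk] := Foo k; split.
  by rewrite -[X in measurable X]setTI; exact: mg.
rewrite /image_measure /pushforward -comp_preimage (_ : g \o f = id)//.
exact/funext.
Qed.

End image_measure.

(* The canonical sigma-finite structure on [m1 \x m2] is shadowed by the one for
   finite measures. *)
Lemma product_sigma_finite d1 d2 (T1 : measurableType d1)
    (T2 : measurableType d2) (R : realType)
    (m1 : {sigma_finite_measure set T1 -> \bar R})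
    (m2 : {sigma_finite_measure set T2 -> \bar R}) :
  sigma_finite setT (m1 \x m2)%E.
Proof.
have /sigma_finiteP[F [TF ndF Foo]] := sigma_finiteT m1.
have /sigma_finiteP[G [TG ndG Goo]] := sigma_finiteT m2.
exists (fun n => F n `*` G n).
  rewrite -setXTT TF TG predeqE => -[x y]; split.
    move=> [/= [n _ Fnx] [k _ Gky]]; exists (maxn n k) => //; split.
    - by move: x Fnx; exact/subsetPset/ndF/leq_maxl.
    - by move: y Gky; exact/subsetPset/ndG/leq_maxr.
  by move=> [n _ []/= ? ?]; split; exists n.
move=> k; have [? ?] := Foo k; have [? ?] := Goo k.
split; first exact: measurableX.
by rewrite product_measure1E// lte_mul_pinfty// ge0_fin_numE.
Qed.

Section lebesgue_tuple.
Variable R : realType.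
Local Notation T := (measurableTypeR R).

Definition tuple_cons n (p : T * n.-tuple T) : n.+1.-tuple T :=
  [tuple of p.1 :: p.2].

Definition tuple_uncons n (t : n.+1.-tuple T) : T * n.-tuple T :=
  (thead t, [tuple of behead t]).

Lemma measurable_tuple_cons n : measurable_fun setT (@tuple_cons n).
Proof. exact: measurable_cons. Qed.

HB.instance Definition _ n :=
  isMeasurableFun.Build _ _ _ _ (@tuple_cons n) (@measurable_tuple_cons n).

Lemma measurable_tuple_uncons n : measurable_fun setT (@tuple_uncons n).
Proof.
apply: measurable_fun_pair; first exact: measurable_tnth.
exact: measurable_behead.
Qed.

Lemma tuple_consK n : cancel (@tuple_cons n) (@tuple_uncons n).
Proof. by case=> x t; congr pair; apply/val_inj. Qed.

Section step.
Variables (n : nat) (m : {sigma_finite_measure set (n.-tuple T) -> \bar R}).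

Definition lebesgue_tupleS : set (n.+1.-tuple T) -> \bar R :=
  image_measure (@lebesgue_measure R \x m)%E (@tuple_cons n).

HB.instance Definition _ := Measure.on lebesgue_tupleS.

Let lebesgue_tupleS_sigma_finite : sigma_finite setT lebesgue_tupleS.
Proof.
apply: (image_measure_sigma_finite (@measurable_tuple_uncons n)
  (@tuple_consK n)); exact: product_sigma_finite.
Qed.

HB.instance Definition _ := Measure_isSigmaFinite.Build _ _ _ lebesgue_tupleS
  lebesgue_tupleS_sigma_finite.

End step.

Fixpoint lebesgue_tuple n : {sigma_finite_measure set (n.-tuple T) -> \bar R} :=
  if n is n'.+1 then lebesgue_tupleS (lebesgue_tuple n')
  else \d_ [tuple].

Definition row_of_tuple n (t : n.-tuple T) : borel 'rV[R]_n :=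
  \row_i tnth t i.

Lemma measurable_row_of_tuple n : measurable_fun setT (@row_of_tuple n).
Proof.
apply: (@measurability _ _ _ (borel _) setT (@row_of_tuple n) (@open 'rV[R]_n)) => //.
move=> _ [U oU <-]; rewrite setTI.
pose B (q : 'rV[rat]_n * nat) : set 'rV[R]_n :=
  [set v | forall i, ball (ratr (q.1 ord0 i) : R) q.2.+1%:R^-1 (v ord0 i)].
have cover (t : n.-tuple T) : U (row_of_tuple t) ->
    exists q, B q `<=` U /\ B q (row_of_tuple t).
  move=> Ut; have : nbhs (row_of_tuple t : 'rV[R]_n) U by exact: open_nbhs_nbhs.
  move=> /nbhs_ballP[e /= e0 eU].
  pose k := Num.truncn (2 / e).
  have ke : k.+1%:R^-1 + k.+1%:R^-1 <= e.
    rewrite -mulr2n -[_ *+ 2]mulr_natl ler_pdivrMr// mulrC -ler_pdivrMr//.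
    by apply/ltW; exact: Num.Theory.truncnS_gt.
  have [q tq] : exists q : 'rV[rat]_n,
      forall i, ball (ratr (q ord0 i) : R) k.+1%:R^-1 (tnth t i).
    have tk i : exists r : rat, ball (ratr r : R) k.+1%:R^-1 (tnth t i).
      have : (tnth t i : R) - k.+1%:R^-1 < (tnth t i : R) + k.+1%:R^-1.
        by rewrite ltrBlDr -addrA ltrDl addr_gt0.
      move=> /rat_in_itvoo[r]; rewrite in_itv/= => /andP[r1 r2].
      exists r; rewrite /ball/= ltr_norml ltrBrDl ltrBlDr.
      by rewrite -ltrBlDr r1 ltrBlDl r2.
    exists (\row_i sval (cid (tk i))) => i; rewrite mxE.
    by case: cid.
  exists (q, k); split => [v /= Bv|i]; last by rewrite mxE.
  apply: eU; split=> // i j; rewrite (ord1 i) mxE.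
  apply: le_ball ke _ _; apply: ball_triangle (Bv j).
  exact/ball_sym/tq.
have -> : @row_of_tuple n @^-1` U =
    \bigcup_(q in [set q | B q `<=` U]) (@row_of_tuple n @^-1` B q).
  apply/seteqP; split => [t /= /cover[q [qU qt]]|t [q /= qU]]; first by exists q.
  exact: qU.
rewrite bigcup_mkcond; apply: countable_bigcupT_measurable => // q.
case: ifP => // _.
have -> : @row_of_tuple n @^-1` B q = \bigcap_(i in [set: 'I_n])
    ((@tnth n T ^~ i) @^-1` ball (ratr (q.1 ord0 i) : R) q.2.+1%:R^-1).
  apply/seteqP; split => t /= Bt i; first by move=> _; have := Bt i; rewrite mxE.
  by rewrite mxE; exact: Bt.
apply: fin_bigcap_measurable => // i _.
rewrite -[X in measurable X]setTI; apply: measurable_tnth => //.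
exact: measurable_ball.
Qed.

HB.instance Definition _ n :=
  isMeasurableFun.Build _ _ _ _ (@row_of_tuple n) (@measurable_row_of_tuple n).

Definition lebesgue_rV n : {measure set (borel 'rV[R]_n) -> \bar R} :=
  image_measure (lebesgue_tuple n) (@row_of_tuple n).

End lebesgue_tuple.

Section polish.
Variables (R : realType) (T : topologicalType).

Definition is_metric (d : T -> T -> R) :=
  [/\ forall x y, 0 <= d x y,
      forall x y, d x y = 0 <-> x = y,
      forall x y, d x y = d y x &
      forall x y z, d x z <= d x y + d y z].

Definition metrizes (d : T -> T -> R) :=
  forall x (U : set T),
    nbhs x U <-> exists2 e : R, 0 < e & [set y | d x y < e] `<=` U.

Definition complete_metric (d : T -> T -> R) :=
  forall u : nat -> T,
    (forall e : R, 0 < e ->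
       exists N, forall i j, (N <= i)%N -> (N <= j)%N -> d (u i) (u j) < e) ->
    exists l : T, u @ \oo --> l.

Definition polish_space :=
  (exists2 D : set T, countable D & dense D) /\
  exists d, [/\ is_metric d, metrizes d & complete_metric d].

End polish.

Definition bounded_measurable (R : realType) (T : ptopologicalType)
    (f : T -> R) :=
  measurable_fun [set: borel T] f /\ exists M : R, forall x, `|f x| <= M.

(* Only the kernels with a nonnegative time index are meaningful. *)
Definition markov_semigroup (R : realType) (T : ptopologicalType)
    (P : R -> R.-pker (borel T) ~> (borel T)) :=
  (forall (x : borel T) (A : set (borel T)), measurable A ->
     P 0 x A = \d_x A) /\
  (forall s t : R, 0 <= s -> 0 <= t ->
     forall (x : borel T) (A : set (borel T)), measurable A ->
     P (s + t) x A = (\int[P s x]_y P t y A)%E).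

Section diffusion.
Variables (R : realType) (n : nat).
Local Notation Rn := 'rV[R]_n.

Definition partial (i : 'I_n) (f : Rn -> R) (x : Rn) : R :=
  'D_(delta_mx ord0 i) f x.

Definition gradient (f : Rn -> R) (x : Rn) : Rn := \row_i partial i f x.

Definition C1 (f : Rn -> R) :=
  (forall x, differentiable f x) /\ continuous (gradient f).

Definition C2 (f : Rn -> R) := C1 f /\ forall i, C1 (partial i f).

Definition compact_support (f : Rn -> R) :=
  exists M : R, forall x, M < `|x| -> f x = 0.

Definition generator (beta : Rn -> Rn) (f : Rn -> R) (x : Rn) : R :=
  \sum_(i < n) (2^-1 * partial i (partial i f) x - beta x ord0 i * partial i f x).

(* Processes and filtrations are indexed by R, but only through times t >= 0. *)
Section sde.
Context d (Omega : measurableType d) (Pr : probability Omega R).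
Variable F : R -> set (set Omega).
Implicit Types X W : R -> Omega -> Rn.

Definition filtration :=
  (forall t : R, 0 <= t -> sigma_algebra setT (F t) /\ F t `<=` measurable) /\
  (forall s t : R, 0 <= s -> s <= t -> F s `<=` F t).

Definition adapted X :=
  forall t : R, 0 <= t -> forall B : set (borel Rn), measurable B ->
    F t (X t @^-1` B).

Definition continuous_paths X :=
  forall w, {within [set t : R | 0 <= t], continuous (X ^~ w)}.

Definition brownian_motion W :=
  [/\ adapted W, continuous_paths W, {ae Pr, forall w, W 0 w = 0} &
      forall s t : R, 0 <= s -> s < t ->
      forall G, F s G ->
      forall B : 'I_n -> set (measurableTypeR R), (forall i, measurable (B i)) ->
        Pr (G `&` [set w | forall i, B i ((W t w - W s w) ord0 i)]) =
        (Pr G * \prod_(i < n) normal_prob 0 (Num.sqrt (t - s)) (B i))%E].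

Definition sde_solution (beta : Rn -> Rn) (x : Rn) W X :=
  [/\ filtration, brownian_motion W, adapted X, continuous_paths X &
      {ae Pr, forall w, forall t : R, 0 <= t -> forall i,
         X t w ord0 i = x ord0 i
           - \int[lebesgue_measure]_(s in `[0, t]) (beta (X s w) ord0 i)
           + W t w ord0 i}].

End sde.

(* The semigroup of dX = - beta(X) dt + dW: laws of weak solutions, together with
   the generator, taken pointwise at t = 0+ on C^2_c. *)
Definition diffusion_semigroup (beta : Rn -> Rn)
    (P : R -> R.-pker (borel Rn) ~> (borel Rn)) :=
  [/\ markov_semigroup P,
      forall x : Rn,
        exists (d : measure_display) (Omega : measurableType d)
               (Pr : probability Omega R) (F : R -> set (set Omega))
               (W X : R -> Omega -> Rn),
          sde_solution Pr F beta x W X /\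
          forall t : R, 0 <= t -> forall A : set (borel Rn), measurable A ->
            P t x A = Pr (X t @^-1` A) &
      forall f, C2 f -> compact_support f -> forall x : Rn,
        t^-1 * ((\int[P t x]_y f y) - f x) @[t --> 0^'+] --> generator beta f x].

End diffusion.

Section link.
Variables (R : realType) (Ds : ptopologicalType) (n : nat).
Local Notation Rn := 'rV[R]_n.

Record link := Link {
  link_fun :> Ds -> Rn -> R;
  link_measurable : measurable_fun [set: borel Ds * borel Rn]
    (fun z => link_fun z.1 z.2);
  link_ge0 : forall xs x, 0 <= link_fun xs x;
  link_int1 : forall xs, (\int[lebesgue_rV R n]_x (link_fun xs x)%:E = 1)%E
}.

Variable l : link.

Definition link_set : set (Ds * Rn) := [set z | 0 < l z.1 z.2].

Definition link_state := set_type link_set.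

HB.instance Definition _ := Topological.on link_state.

Lemma link_set_nonempty : exists z : Ds * Rn, z \in link_set.
Proof.
apply: contrapT => l0; have := link_int1 l point.
rewrite integral0_eq => [/esym/eqP|x _]; first by rewrite onee_eq0.
congr EFin; apply/eqP; rewrite eq_le link_ge0 andbT leNgt.
by apply/negP => lx; apply: l0; exists (point, x); rewrite inE.
Qed.

HB.instance Definition _ := isPointed.Build link_state
  (exist _ (sval (cid link_set_nonempty)) (svalP (cid link_set_nonempty))).

(* [xs |-> \int l(xs, x) f(xs, x) dx]; [f] is only defined where [l > 0], and
   is extended by 0. *)
Definition link_integral (f : link_state -> \bar R) (xs : Ds) : \bar R :=
  (\int[lebesgue_rV R n]_x ((l xs x)%:E * 'valL_(0%E) f (xs, x)))%E.

Definition linked (V : R -> R.-pker (borel link_state) ~> (borel link_state))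
    (P : R -> R.-pker (borel Rn) ~> (borel Rn))
    (Q : R -> R.-pker (borel Ds) ~> (borel Ds)) :=
  (forall t : R, 0 <= t -> forall f : Rn -> R, bounded_measurable f ->
     forall z : link_state,
     (\int[V t z]_w (f (\val w).2)%:E = \int[P t (\val z).2]_y (f y)%:E)%E) /\
  (forall t : R, 0 <= t -> forall g : link_state -> R, bounded_measurable g ->
     forall xs : Ds,
     (link_integral (fun z => \int[V t z]_w (g w)%:E) xs =
      \int[Q t xs]_ys link_integral (EFin \o g) ys)%E).

End link.

Section path_space.
Variables (R : realType) (T : ptopologicalType).

Definition time := set_type [set t : R | 0 <= t].

HB.instance Definition _ := Topological.on time.

Definition time0 : time :=
  @exist _ (fun t => t \in [set t : R | 0 <= t]) 0 (mem_set (lexx 0)).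

Definition path := set_type [set f : time -> T | continuous f].

Definition cst_path (x : T) : path :=
  @exist _ (fun f => f \in [set f : time -> T | continuous f]) (fun=> x)
    (mem_set (@cst_continuous time T x)).

HB.instance Definition _ := Choice.on path.
HB.instance Definition _ := isPointed.Build path (cst_path point).

Definition canonical_process (t : time) (w : path) : T := \val w t.

(* The cylinder sigma-algebra; it is the Borel sigma-algebra of C(R_+, T) for
   locally uniform convergence when T is Polish. *)
Definition cylinders : set (set path) :=
  [set A | exists t (B : set (borel T)),
     measurable B /\ A = canonical_process t @^-1` B].

Definition path_space := g_sigma_algebraType cylinders.

(* [fdd V t B k i z] is
   \int_(B_(i+1)) V_(t_(i+1) - t_i)(z, dz_1) ...
     \int_(B_(i+k)) V_(t_(i+k) - t_(i+k-1))(z_(k-1), dz_k). *)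
Fixpoint fdd (V : R -> R.-pker (borel T) ~> (borel T)) (t : nat -> time)
    (B : nat -> set (borel T)) (k i : nat) (z : T) : \bar R :=
  if k is k'.+1 then
    (\int[V (\val (t i.+1) - \val (t i))%R z]_(w in B i.+1)
       fdd V t B k' i.+1 w)%E
  else 1%E.

Section markov_process.
Context d (Omega : measurableType d) (Pr : probability Omega R).

Definition natural_filtration (X : time -> Omega -> T) (s : time) :
    set (set Omega) :=
  <<s [set G | exists u (B : set (borel T)),
         [/\ \val u <= \val s, measurable B & G = X u @^-1` B]] >>.

Definition is_cond_prob (F : set (set Omega)) (A : set Omega)
    (Z : Omega -> \bar R) :=
  (forall U : set (\bar R), measurable U -> F (Z @^-1` U)) /\
  forall G, F G -> (\int[Pr]_(w in G) Z w = Pr (A `&` G))%E.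

Definition markov_process (X : time -> Omega -> T)
    (Q : R -> R.-pker (borel T) ~> (borel T)) :=
  (forall t, measurable_fun [set: Omega] (X t : Omega -> borel T)) /\
  forall s t : time, \val s <= \val t ->
  forall A : set (borel T), measurable A ->
    is_cond_prob (natural_filtration X s) (X t @^-1` A)
      (fun w => Q (\val t - \val s) (X s w) A).

End markov_process.

End path_space.

(* Main.v *)
From HB Require Import structures.
Require Import Defs.
From mathcomp Require Import all_boot all_order all_algebra.
From mathcomp Require Import all_classical all_reals all_analysis.
From mathcomp Require Import measurable_realfun.
Set Implicit Arguments.
Unset Strict Implicit.
Unset Printing Implicit Defensive.
Import Order.TTheory GRing.Theory Num.Theory numFieldNormedType.Exports.
Local Open Scope classical_set_scope.
Local Open Scope ring_scope.

(** The link intertwines the two semigroups: averaging over [x] with the density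
    [lambda xs] turns [V] into [Q].  Take measurable sets that constrain only the
    [Ds]-coordinate.  The indicator of such a set comes out of the averaging, so
    the intertwining relation can be applied once per time step, starting from the
    earliest time, and turns the finite-dimensional integrals of [V] started from
    [lambda xs0] into those of [Q] started from the point [xs0]
    ([link_integral_fdd]; the induction ends because [lambda xs] has mass one).
    Thus the process [Xs] has the finite-dimensional distributions of a Markov
    process with semigroup [Q] started at [xs0].

    The rest no longer involves the link: a process with the finite-dimensional
    distributions of a semigroup [K] from a point [x0] starts at [x0]
    ([initial_state_of_fdd]) and has the Markov property ([markov_of_fdd]).  For the
    latter, both sides of the defining identity of the conditional probability are
    finite measures in the conditioning event, so it suffices to compare them on
    the intersection-stable family of cylinders over times up to [s], which
    generates the past of [s].  A cylinder can be written over an increasing grid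
    of times ending exactly at [s] ([cylinder_seqE]); on such a grid, integrating
    [K (u - s) (X s) C] over the cylinder appends the time [u] to the grid
    ([integral_cylinder_kernel]).  This last step uses the finite-dimensional
    formula with a function, not a set, at the last time ([integral_cylinder]); it
    passes from sets to functions because the iterated integral is integration
    against a single kernel ([fdd_integral_kernel]). *)

(** * Iterated integrals of kernels *)

Lemma integral_mrestr d (T : measurableType d) (R : realType)
    (mu : {measure set T -> \bar R}) (D : set T) (mD : measurable D)
    (f : T -> \bar R) :
  measurable_fun setT f -> (forall x, 0 <= f x)%E ->
  (\int[mrestr mu mD]_x f x = \int[mu]_(x in D) f x)%E.
Proof.
move=> mf f0.
rewrite (@ge0_negligible_integral _ _ _ (mrestr mu mD) setT (~` D))//; last 2 first.
- exact: measurableC.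
- by rewrite /= /mrestr setICl measure0.
rewrite setDE setTI setCK; apply: eq_measure_integral => A mA AD.
by rewrite /= /mrestr setIidl.
Qed.

Section kernel_if.
Context d1 d2 d3 (X : measurableType d1) (Y : measurableType d2)
  (Z : measurableType d3) (R : realType).
Variables (A : set Y) (mA : measurable A) (K : R.-fker Y ~> Z).

(** Composing with this kernel restricts the intermediate variable to [A]: the
    integral over [A] of a composition becomes an unrestricted one. *)
Definition kernel_if (p : X * Y) : {measure set Z -> \bar R} :=
  if p.2 \in A then K p.2 else mzero.

Let kernel_ifE U : kernel_if ^~ U = ((K ^~ U) \_ A) \o snd.
Proof.
by apply/funext => p; rewrite /kernel_if /= patchE; case: ifP.
Qed.

Let measurable_kernel_if U :
  measurable U -> measurable_fun [set: X * Y] (kernel_if ^~ U).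
Proof.
move=> mU; rewrite kernel_ifE; apply: measurableT_comp => //.
apply/(measurable_restrictT _ mA)/measurable_funTS.
exact: measurable_kernel.
Qed.

HB.instance Definition _ :=
  isKernel.Build _ _ _ _ R kernel_if measurable_kernel_if.

Let kernel_if_uub : measure_fam_uub kernel_if.
Proof.
have /measure_fam_uubP[r Kr] := measure_uub K.
exists r%:num => p; rewrite /kernel_if; case: ifP => [_|_] /=; first exact: Kr.
by rewrite /mzero lte_fin.
Qed.

HB.instance Definition _ :=
  Kernel_isFinite.Build _ _ _ _ R kernel_if kernel_if_uub.

Import KCOMP_FINITE_KERNEL.

Lemma fkernel_comp_on (J : R.-fker X ~> Y) :
  exists L : R.-fker X ~> Z, forall h : Z -> \bar R,
    measurable_fun setT h -> (forall z, 0 <= h z)%E ->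
    forall x, (\int[L x]_z h z = \int[J x]_(y in A) \int[K y]_z h z)%E.
Proof.
exists (J \; kernel_if)%E => h mh h0 x /=.
rewrite integral_kcomp// [RHS]integral_mkcond; apply: eq_integral => y _.
rewrite -[LHS]/(\int[if y \in A then K y else mzero]_z h z)%E patchE.
by case: ifP => // _; rewrite integral_measure_zero.
Qed.

End kernel_if.

Section fdd_integral.
Variables (R : realType) (T : ptopologicalType).
Variable K : R -> R.-pker (borel T) ~> (borel T).
Variable t : nat -> time R.
Implicit Types (B : nat -> set (borel T)) (h : borel T -> \bar R).

(** [fdd] with an arbitrary function [h] of the last state in place of [1]. *)
Fixpoint fdd_integral B h (k i : nat) (z : borel T) : \bar R :=
  if k is k'.+1 then
    (\int[K (\val (t i.+1) - \val (t i))%R z]_(w in B i.+1)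
       fdd_integral B h k' i.+1 w)%E
  else h z.

Lemma fdd_integral1 B k i : fdd K t B k i = fdd_integral B (cst 1%E) k i.
Proof.
by apply/funext; elim: k i => [|k IH] i z //=; apply: eq_integral => w _; rewrite IH.
Qed.

(** [fdd_integral] unfolds from the earliest time; the Markov property acts at the
    latest one, hence this unfolding from the other end. *)
Lemma fdd_integralSr B h k i :
  fdd_integral B h k.+1 i =
  fdd_integral B (fun z =>
    \int[K (\val (t (i + k).+1) - \val (t (i + k)%N))%R z]_(w in B (i + k).+1)
      h w)%E k i.
Proof.
elim: k i => [|k IH] i; first by rewrite addn0.
apply/funext => z; rewrite -addSnnS.
transitivity (\int[K (\val (t i.+1) - \val (t i)) z]_(w in B i.+1)
  fdd_integral B h k.+1 i.+1 w)%E => //.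
by rewrite IH.
Qed.

Variable B : nat -> set (borel T).
Hypothesis mB : forall i, measurable (B i).

(** The kernel does not depend on the terminal function [h]: this is what lets an
    identity known for indicators [h], that is, for sets, pass to all
    nonnegative measurable [h]. *)
Lemma fdd_integral_kernel k i :
  exists L : R.-fker (borel T) ~> (borel T), forall h,
    measurable_fun setT h -> (forall z, 0 <= h z)%E ->
    forall z, (fdd_integral B h k i z = \int[L z]_w h w)%E.
Proof.
elim: k i => [|k IH] i.
  exists (kdirac (@measurable_id _ (borel T) setT)) => h mh h0 z /=.
  by rewrite integral_dirac// diracT mul1e.
have [L LE] := IH i.+1.
have [M ME] := fkernel_comp_on (mB i.+1) L
  (K (\val (t i.+1) - \val (t i))).
exists M => h mh h0 z; rewrite ME//=.
by apply: eq_integral => w _; rewrite LE.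
Qed.

Lemma fdd_ge0 k i z : (0 <= fdd K t B k i z)%E.
Proof.
by elim: k i z => [|k IH] i z //=; apply: integral_ge0 => w _; exact: IH.
Qed.

Lemma measurable_fdd k i : measurable_fun setT (fdd K t B k i : borel T -> _).
Proof.
have [L LE] := fdd_integral_kernel k i.
rewrite fdd_integral1 (_ : fdd_integral _ _ _ _ = L ^~ setT).
  exact: measurable_kernel.
apply/funext => z; rewrite LE//.
by rewrite integral_cst// mul1e.
Qed.

Lemma fdd_le1 k i z : (fdd K t B k i z <= 1)%E.
Proof.
elim: k i z => [|k IH] i z //=.
apply: (@le_trans _ _ (\int[K (\val (t i.+1) - \val (t i)) z]_(w in B i.+1) cst 1 w)%E).
  apply: ge0_le_integral => //.
  - by move=> w _; exact: fdd_ge0.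
  - by apply: measurable_funTS; exact: measurable_fdd.
rewrite integral_cst// mul1e -(prob_kernel (s := K (\val (t i.+1) - \val (t i))) z).
by apply: le_measure; rewrite ?inE.
Qed.

End fdd_integral.

Lemma eq_fdd_integral (R : realType) (T : ptopologicalType)
    (K : R -> R.-pker (borel T) ~> (borel T)) (t t' : nat -> time R)
    (B B' : nat -> set (borel T)) h k i :
  (forall j, (i <= j <= i + k)%N -> t j = t' j) ->
  (forall j, (i < j <= i + k)%N -> B j = B' j) ->
  fdd_integral K t B h k i = fdd_integral K t' B' h k i.
Proof.
elim: k i => [//|k IH] i tt BB; apply/funext => z /=.
rewrite !tt ?BB ?leqnn ?leqnSn ?leq_addr ?addnS ?ltnS ?leq_addr//.
rewrite IH// => j; rewrite addSn -addnS => /andP[ij jk].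
  by rewrite tt// jk (ltnW ij).
by rewrite BB// jk (ltnW ij).
Qed.

(** * From the linked semigroup to the marginal one *)

Lemma continuous_borel_measurable (T U : ptopologicalType) (f : T -> U) :
  continuous f -> measurable_fun setT (f : borel T -> borel U).
Proof.
move=> cf; apply: (@measurability _ _ (borel T) (borel U) setT f (@open U)) => //.
move=> _ [B oB <-]; rewrite setTI; apply: sub_sigma_algebra.
by move/continuousP : cf; exact.
Qed.

Section link_integral.
Variables (R : realType) (Ds : ptopologicalType) (n : nat) (l : link R Ds n).
Implicit Types (f : link_state l -> \bar R) (xs : Ds).

Definition link_base (z : link_state l) : Ds := (\val z).1.

Lemma continuous_link_base : continuous link_base.
Proof.
move=> z; apply: continuous_comp; last exact: cvg_fst.
exact: initial_continuous.
Qed.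

Lemma measurable_link_base :
  measurable_fun setT (link_base : borel (link_state l) -> borel Ds).
Proof. exact: continuous_borel_measurable continuous_link_base. Qed.

(** Where [f] is undefined the density is zero, so the integrand is known from the
    values of [f] alone. *)
Lemma link_integrandE f xs x :
  ((l xs x)%:E * 'valL_(0%E) f (xs, x))%E =
  if pselect (0 < l xs x) is left lx
  then ((l xs x)%:E * f (exist _ (xs, x) (mem_set lx)))%E else 0%E.
Proof.
case: pselect => [lx|lx].
  congr (_ * _)%E.
  exact: (congr1 (@^~ (exist _ (xs, x) (mem_set lx))) (valLK 0%E f)).
have -> : l xs x = 0; last by rewrite mul0e.
by apply/eqP; rewrite eq_le link_ge0 andbT leNgt; apply/negP.
Qed.

(** A constraint on the [Ds]-coordinate is constant along the integration variable
    of [link_integral], so it can be taken out. *)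
Lemma link_integral_patch f (A : set Ds) xs :
  link_integral (f \_ (link_base @^-1` A)) xs = (link_integral f \_ A) xs.
Proof.
rewrite /link_integral patchE; case: ifPn => xsA.
  apply: eq_integral => x _; rewrite !link_integrandE; case: pselect => // lx.
  by rewrite patchE ifT// inE; rewrite inE in xsA.
apply: integral0_eq => x _; rewrite link_integrandE; case: pselect => // lx.
by rewrite patchE ifF ?mule0//; apply: contraNF xsA; rewrite !inE.
Qed.

Lemma link_integral_cst1 xs : link_integral (cst 1%E : link_state l -> _) xs = 1%E.
Proof.
rewrite -[RHS](link_int1 l xs); apply: eq_integral => x _.
rewrite link_integrandE; case: pselect => [lx|lx]; first by rewrite mule1.
by apply/esym/congr1/eqP; rewrite eq_le link_ge0 andbT leNgt; apply/negP.
Qed.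

Variables (P : R -> R.-pker (borel 'rV[R]_n) ~> (borel 'rV[R]_n))
  (Q : R -> R.-pker (borel Ds) ~> (borel Ds))
  (V : R -> R.-pker (borel (link_state l)) ~> (borel (link_state l))).
Hypothesis VPQ : linked V P Q.

(** The intertwining relation applies to the real bounded function
    [fdd _ _ _ k i.+1] cut off outside the first set; the cutoff then comes out
    of the link, and what is left is the same statement for the remaining times. *)
Lemma link_integral_fdd (t : nat -> time R) (A : nat -> set (borel Ds)) k i xs :
  (forall j, measurable (A j)) ->
  (forall j, (i <= j < i + k)%N -> \val (t j) <= \val (t j.+1)) ->
  link_integral (fdd V t (fun j => link_base @^-1` A j) k i) xs =
  fdd Q t A k i xs.
Proof.
move=> mA; elim: k i xs => [|k IH] i xs tle; first exact: link_integral_cst1.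
have mB j : measurable (link_base @^-1` A j : set (borel (link_state l))).
  by rewrite -[X in measurable X]setTI; exact: measurable_link_base.
set B := fun j : nat => _ in mB *.
pose f : borel (link_state l) -> \bar R := (fdd V t B k i.+1) \_ (B i.+1).
have mf : measurable_fun setT f.
  apply/(measurable_restrictT _ (mB _))/measurable_funTS.
  exact: measurable_fdd.
have f01 w : (0 <= f w <= 1)%E.
  rewrite /f patchE; case: ifP => _; last by rewrite lexx lee01.
  by rewrite fdd_ge0 fdd_le1.
have fE w : (fine (f w))%:E = f w.
  have /andP[f0 f1] := f01 w.
  by rewrite fineK// ge0_fin_numE// (le_lt_trans f1)// ltry.
have fb : bounded_measurable (T := link_state l) (fine \o f).
  split; first exact: measurableT_comp.
  exists 1 => w /=; have /andP[f0 f1] := f01 w.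
  by rewrite ger0_norm ?fine_ge0// -lee_fin fE.
(* the intertwining relation is available for nonnegative durations only *)
have t0 : 0 <= \val (t i.+1) - \val (t i).
  by rewrite subr_ge0 tle// leqnn addnS ltnS leq_addr.
transitivity (link_integral (fun z =>
    \int[V (\val (t i.+1) - \val (t i)) z]_w ((fine \o f) w)%:E)%E xs).
  congr (link_integral _ xs); apply/funext => z /=.
  by rewrite integral_mkcond; apply: eq_integral => w _; rewrite fE.
rewrite (VPQ.2 _ t0 _ fb) /= [RHS]integral_mkcond.
apply: eq_integral => ys _.
rewrite (_ : EFin \o _ = f); last by apply/funext => w; exact: fE.
rewrite link_integral_patch !patchE; case: ifP => // _; apply: IH => j.
by rewrite addSnnS => /andP[ij jk]; rewrite tle// jk (ltnW ij).
Qed.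

End link_integral.

(** * Processes with the finite-dimensional distributions of a semigroup *)

Section markov_of_fdd.
Context d (Omega : measurableType d) (R : realType) (Pr : probability Omega R).
Variables (T : ptopologicalType) (X : time R -> Omega -> T).
Variables (K : R -> R.-pker (borel T) ~> (borel T)) (x0 : T).
Hypothesis mX : forall t, measurable_fun setT (X t : Omega -> borel T).
Hypothesis K0 : forall (x : borel T) (A : set (borel T)), measurable A ->
  K 0 x A = \d_x A.

Definition time_grid N (t : nat -> time R) :=
  [/\ (0 < N)%N, t 0%N = time0 R, \val (t 0%N) <= \val (t 1%N) &
      forall i, (1 <= i < N)%N -> \val (t i) < \val (t i.+1)].

Definition cylinder N (t : nat -> time R) (B : nat -> set (borel T)) :=
  [set w | forall i, (1 <= i <= N)%N -> B i (X (t i) w)].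

Hypothesis fddX : forall N t B, time_grid N t -> (forall i, measurable (B i)) ->
  Pr (cylinder N t B) = fdd K t B N 0 x0.

Lemma measurable_preimage_process t (A : set (borel T)) :
  measurable A -> measurable (X t @^-1` A).
Proof. by move=> mA; rewrite -[X in measurable X]setTI; exact: mX. Qed.

Lemma cylinderS N t B :
  cylinder N.+1 t B = cylinder N t B `&` (X (t N.+1) @^-1` B N.+1).
Proof.
apply/seteqP; split => [w Bw|w [Bw BNw] i /andP[i1]].
  by split => [i /andP[i1 iN]|]; apply: Bw; rewrite ?i1 ?leqnn// leqW.
by rewrite leq_eqVlt => /predU1P[->//|iN]; apply: Bw; rewrite i1.
Qed.

Lemma eq_cylinder N t t' B B' :
  (forall i, (1 <= i <= N)%N -> t i = t' i) ->
  (forall i, (1 <= i <= N)%N -> B i = B' i) ->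
  cylinder N t B = cylinder N t' B'.
Proof.
move=> tt BB; apply/seteqP; split => w Bw i iN.
  by rewrite -BB// -tt//; exact: Bw.
by rewrite BB// tt//; exact: Bw.
Qed.

Lemma measurable_cylinder N t B :
  (forall i, measurable (B i)) -> measurable (cylinder N t B).
Proof.
move=> mB; elim: N => [|N IH].
  rewrite (_ : cylinder _ _ _ = setT)//; apply/seteqP; split => // w _ i.
  by rewrite leqn0 => /andP[/lt0n_neq0/negbTE ->].
rewrite cylinderS; apply: measurableI => //.
exact: measurable_preimage_process.
Qed.

(** For [h] the indicator of [C] this is [fddX] with the last set intersected with
    [C], so the law of [X (t N)] on the cylinder is the kernel that represents
    the iterated integral, and the two integrate every [h] alike. *)
Lemma integral_cylinder N t B (h : borel T -> \bar R) : time_grid N t ->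
  (forall i, measurable (B i)) ->
  measurable_fun setT h -> (forall z, 0 <= h z)%E ->
  (\int[Pr]_(w in cylinder N t B) h (X (t N) w) =
   fdd_integral K t B h N 0 x0)%E.
Proof.
move=> gt mB mh h0.
have mG := measurable_cylinder N t mB.
have [L LE] := fdd_integral_kernel K t mB N 0.
have mhX : measurable_fun setT (h \o X (t N)) by exact: measurableT_comp mh _.
rewrite LE// -(integral_mrestr Pr mG mhX); last by move=> w; exact: h0.
rewrite -[LHS](ge0_integral_pushforward (mX (t N)) (mrestr Pr mG) (D := setT))//.
apply: eq_measure_integral => C mC _; rewrite /= /pushforward /mrestr.
case: N gt {mh h0 mhX} mG L LE => [[]//|N gt mG L LE].
pose B' i := if i == N.+1 then B i `&` C else B i.
have mB' i : measurable (B' i).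
  by rewrite /B'; case: ifP => // _; exact: measurableI.
have BB i : (i <= N)%N -> B i = B' i by move=> iN; rewrite /B' ltn_eqF.
transitivity (Pr (cylinder N.+1 t B')).
  rewrite !cylinderS {2}/B' eqxx preimage_setI setIC -setIA.
  by rewrite (eq_cylinder (t' := t) (B' := B'))// => i /andP[_]; exact: BB.
rewrite fddX// fdd_integral1 fdd_integralSr.
transitivity (fdd_integral K t B (EFin \o \1_C) N.+1 0 x0); last first.
  rewrite LE ?integral_indic ?setIT//.
  - by apply/measurable_EFinP; exact: measurable_indic.
  - by move=> z; rewrite lee_fin.
rewrite fdd_integralSr (@eq_fdd_integral _ _ K t t B B')//; last first.
  by move=> j /andP[_]; exact: BB.
congr (fdd_integral _ _ _ _ _ _ x0); apply/funext => z.
rewrite add0n /B' eqxx integral_cst; last exact: measurableI.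
by rewrite mul1e integral_indic// setIC.
Qed.

(** The Markov property on cylinders over a grid ending at the present.  When
    [u] is later than the present it can be appended to the grid; when it is the
    present, the grid cannot grow and [K 0] being the Dirac kernel is what makes
    the identity hold. *)
Lemma integral_cylinder_kernel N t u B (C : set (borel T)) : time_grid N t ->
  \val (t N) <= \val u -> (forall i, measurable (B i)) -> measurable C ->
  (\int[Pr]_(w in cylinder N t B) K (\val u - \val (t N)) (X (t N) w) C =
   Pr (X u @^-1` C `&` cylinder N t B))%E.
Proof.
move=> gt; rewrite le_eqVlt => /predU1P[/val_inj <-|tu] mB mC.
  rewrite subrr -(integral_indic _ (measurable_cylinder N t mB))//; last first.
    exact: measurable_preimage_process.
  apply: eq_integral => w _; rewrite K0//.
rewrite (integral_cylinder (h := fun z => K (\val u - \val (t N)) z C))//; last first.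
  exact: measurable_kernel.
pose t' i := if (i <= N)%N then t i else u.
pose B' i := if (i <= N)%N then B i else C.
have tt i : (i <= N)%N -> t i = t' i by rewrite /t' => ->.
have BB i : (i <= N)%N -> B i = B' i by rewrite /B' => ->.
have tN : t' N.+1 = u by rewrite /t' ltnn.
have BN : B' N.+1 = C by rewrite /B' ltnn.
have gt' : time_grid N.+1 t'.
  have [N0 t0 t1 tS] := gt; split; [by []|by rewrite -tt|by rewrite -!tt|].
  move=> i /andP[i1]; rewrite ltnS leq_eqVlt => /predU1P[->|iN].
    by rewrite tN -tt.
  by rewrite -!tt ?(ltnW iN)//; apply: tS; rewrite i1.
transitivity (fdd K t' B' N.+1 0 x0).
  rewrite fdd_integral1 fdd_integralSr.
  rewrite (@eq_fdd_integral _ _ K t t' B B'); last 2 first.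
  - by move=> j /andP[_]; exact: tt.
  - by move=> j /andP[_]; exact: BB.
  congr (fdd_integral _ _ _ _ _ _ x0); apply/funext => z.
  by rewrite add0n tN BN -tt// integral_cst// mul1e.
rewrite -fddX//; last by move=> i; rewrite /B'; case: ifP.
rewrite cylinderS tN BN setIC; congr (Pr (_ `&` _)).
by apply: eq_cylinder => i /andP[_ iN]; rewrite -(tt, BB).
Qed.

(** Cylinders over unordered, possibly repeated times: this family is visibly stable
    under intersection, by concatenation of the time sequences. *)
Definition cylinder_seq (us : seq (time R)) (A : time R -> set (borel T)) :=
  [set w | forall u, u \in us -> A u (X u w)].

(** Sorting the times and removing duplicates gives a grid; [s] is always put last,
    with no constraint on the state unless [s] is one of the given times, so that
    the grid ends at the present. *)
Lemma cylinder_seqE s us A : (forall u, u \in us -> \val u <= \val s) ->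
  (forall u, measurable (A u)) ->
  exists N t B, [/\ time_grid N t, t N = s, (forall i, measurable (B i)) &
    cylinder_seq us A = cylinder N t B].
Proof.
move=> us_s mA.
pose le_time := fun u v : time R => \val u <= \val v.
pose ws := sort le_time (undup [seq u <- us | \val u < \val s]).
pose vs := rcons ws s.
(* index 0 of a grid is reserved for time 0, at which no set is imposed *)
pose t := nth s (time0 R :: vs).
pose B i : set (borel T) := if t i \in us then A (t i) else setT.
have ws_in u : (u \in ws) = (\val u < \val s) && (u \in us).
  by rewrite mem_sort mem_undup mem_filter.
have us_vs u : u \in us -> u \in vs.
  move=> uus; rewrite mem_rcons inE ws_in uus andbT.
  have := us_s _ uus; rewrite le_eqVlt => /predU1P[/val_inj ->|->].
    by rewrite eqxx.
  by rewrite orbT.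
have wslt i j : (i < j < size ws)%N -> \val (nth s ws i) < \val (nth s ws j).
  move=> /andP[ij jw]; rewrite lt_neqAle; apply/andP; split.
    rewrite (inj_eq val_inj) nth_uniq ?sort_uniq ?undup_uniq//.
      by rewrite ltn_eqF.
    exact: ltn_trans jw.
  apply: (@sorted_leq_nth _ le_time) => //.
  - by move=> ? ? ?; exact: le_trans.
  - by move=> ?; exact: lexx.
  - by apply: sort_sorted => u v; exact: le_total.
  - by rewrite inE (ltn_trans ij).
  - exact: ltnW.
exists (size vs), t, B; split.
- split => //; first by rewrite size_rcons.
    by rewrite /t /=; exact: (set_mem (valP (nth s vs 0))).
  move=> [//|i] /andP[_]; rewrite size_rcons ltnS => iw.
  rewrite /t /= !nth_rcons iw; case: ltnP => [iSw|wi].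
    by apply: wslt; rewrite ltnSn.
  rewrite if_same; have : nth s ws i \in ws by exact: mem_nth.
  by rewrite ws_in => /andP[].
- by rewrite /t size_rcons /= nth_rcons ltnn eqxx.
- by move=> i; rewrite /B; case: ifP.
- apply/seteqP; split => [w Aw [//|i] /andP[_ iN]|w Bw u /[dup] uus].
    by rewrite /B; case: ifP => // tus; exact: Aw.
  move/us_vs => uvs.
  have := Bw (index u vs).+1; rewrite /B /t /= nth_index// uus; apply.
  by rewrite index_mem.
Qed.

(** Measures that agree on an intersection-stable generator of the past of [s]
    agree on the whole past. *)
Theorem markov_of_fdd : markov_process Pr X K.
Proof.
split => // s u su C mC; split.
  move=> U mU; apply: sub_sigma_algebra.
  exists s, ((fun z => K (\val u - \val s) z C) @^-1` U); split => //.
  by rewrite -[X in measurable X]setTI; exact: measurable_kernel.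
pose Z w := K (\val u - \val s) (X s w) C.
have mZ : measurable_fun setT Z.
  apply: (measurableT_comp (f := fun z => K (\val u - \val s) z C)) => //.
  exact: measurable_kernel.
have Z0 w : (0 <= Z w)%E by [].
have mCu := measurable_preimage_process u mC.
pose m1_fun (G : set Omega) := (\int[Pr]_(w in G) Z w)%E.
have m1_0 : m1_fun set0 = 0%E by exact: integral_set0.
have m1_ge0 G : (0 <= m1_fun G)%E by exact: integral_ge0.
have m1_sigma : semi_sigma_additive m1_fun by exact: semi_sigma_additive_nng_induced.
pose m1_build := isMeasure.Build d Omega R m1_fun m1_0 m1_ge0 m1_sigma.
pose m1 : {measure set Omega -> \bar R} := HB.pack m1_fun m1_build.
pose cyls := [set G | exists us A,
  [/\ forall v, v \in us -> \val v <= \val s, forall v, measurable (A v) &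
      G = cylinder_seq us A]].
move=> G FG; rewrite setIC.
apply: (@g_sigma_algebra_measure_unique _ _ _ cyls _ (fun=> setT) _ _ m1
  (mrestr Pr mCu)).
- move=> _ [us [A [us_s mA ->]]].
  have [N [t [B [_ _ mB ->]]]] := cylinder_seqE us_s mA.
  exact: measurable_cylinder.
- move=> _; exists [::], (fun=> setT); split => //.
  by apply/seteqP; split => // w _ v.
- by rewrite bigcup_const.
- move=> _ _ [us [A [us_s mA ->]]] [us' [A' [us_s' mA' ->]]].
  exists (us ++ us'), (fun v => (if v \in us then A v else setT) `&`
    (if v \in us' then A' v else setT)); split.
  + by move=> v; rewrite mem_cat => /orP[/us_s|/us_s'].
  + by move=> v; apply: measurableI; case: ifP.
  + apply/seteqP; split => [w [Aw Aw'] v _|w Aw].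
      by split; case: ifP => // vus; [exact: Aw|exact: Aw'].
    by split => v vus; have := Aw v; rewrite mem_cat vus ?orbT => /(_ isT)[].
- move=> _ [us [A [us_s mA ->]]].
  have [N [t [B [gt tN mB ->]]]] := cylinder_seqE us_s mA.
  rewrite /= /mrestr setIC -integral_cylinder_kernel ?tN//.
- move=> _; apply: (@le_lt_trans _ _ (\int[Pr]_w cst 1 w)%E).
    apply: ge0_le_integral => // w _.
    rewrite /Z -(prob_kernel (s := K (\val u - \val s)) (X s w)).
    by apply: le_measure; rewrite ?inE.
  by rewrite integral_cst// mul1e (le_lt_trans (probability_le1 _ _))// ltry.
- apply: sub_sigma_algebra2 FG => _ [v [A [vs mA ->]]].
  exists [:: v], (fun=> A); split => //.
    by move=> r; rewrite inE => /eqP ->.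
  apply/seteqP; split => [w Aw r|w]; first by rewrite inE => /eqP ->.
  by apply; rewrite inE.
Qed.

(** The one-point grid at time 0 gives [X] at time 0 the law [K 0 x0], the Dirac
    mass at [x0]. *)
Lemma initial_state_of_fdd :
  measurable ([set x0] : set (borel T)) -> {ae Pr, forall w, X (time0 R) w = x0}.
Proof.
move=> mx0; exists (X (time0 R) @^-1` (~` [set x0])); split => //.
- by apply: measurable_preimage_process; exact: measurableC.
- have gt : time_grid 1 (fun=> time0 R) by split => // -[].
  have mB (i : nat) : measurable (~` [set x0] : set (borel T)).
    exact: measurableC.
  have := fddX gt mB; rewrite cylinderS /= integral_cst; last exact: measurableC.
  rewrite mul1e subrr.
  rewrite K0//; last exact: measurableC.
  rewrite diracE memNset; last by move=> /(_ erefl).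
  move=> Pr0; rewrite [RHS](_ : _ = (false%:R)%:E)// -Pr0.
  congr (Pr _); rewrite (_ : cylinder _ _ _ = setT) ?setTI//.
  apply/seteqP; split => // w _ i.
  by rewrite leqn0 => /andP[/lt0n_neq0/negbTE ->].
Qed.

End markov_of_fdd.

(** Points are closed in a metrizable space. *)
Lemma polish_space_measurable1 (R : realType) (T : ptopologicalType) (x : T) :
  polish_space R T -> measurable ([set x] : set (borel T)).
Proof.
move=> [_ [dist [[d0 deq dsym dtri] dnbhs _]]].
rewrite -[[set x]]setCK; apply: measurableC; apply: sub_sigma_algebra.
rewrite openE => y /= yx; apply/dnbhs; exists (dist y x).
  rewrite lt_neqAle d0 andbT eq_sym; apply/eqP => /deq; exact: yx.
by move=> z /= + zx; rewrite zx ltxx.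
Qed.

(** * The marginal of a linked process is Markov *)

Theorem theorem3p3 (R : realType) (n : nat)
  (Ds : ptopologicalType) (Ds_polish : polish_space R Ds)
  (gamma nu : 'rV[R]_n -> R) (beta : 'rV[R]_n -> 'rV[R]_n)
  (gamma_C1 : C1 gamma)
  (nuE : forall x, nu x = expR (- 2 * gamma x))
  (betaE : forall x, beta x = gradient gamma x)
  (P : R -> R.-pker (borel 'rV[R]_n) ~> (borel 'rV[R]_n))
  (P_diffusion : diffusion_semigroup beta P)
  (lambda : link R Ds n)
  (E_polish : polish_space R (link_state lambda))
  (Q : R -> R.-pker (borel Ds) ~> (borel Ds))
  (Q_semigroup : markov_semigroup Q)
  (V : R -> R.-pker (borel (link_state lambda)) ~> (borel (link_state lambda)))
  (V_semigroup : markov_semigroup V)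
  (V_linked : linked V P Q)
  (xs0 : Ds)
  (PV : probability (path_space R (link_state lambda)) R)
  (PV_fdd : forall (N : nat) (t : nat -> time R)
      (B : nat -> set (borel (link_state lambda))),
    (0 < N)%N ->
    t 0%N = time0 R ->
    \val (t 0%N) <= \val (t 1%N) ->
    (forall i, (1 <= i < N)%N -> \val (t i) < \val (t i.+1)) ->
    (forall i, measurable (B i)) ->
    PV [set w | forall i, (1 <= i <= N)%N -> B i (canonical_process (t i) w)] =
    link_integral (fdd V t B N 0) xs0) :
  let Xs (t : time R) (w : path_space R (link_state lambda)) : Ds :=
    (\val (canonical_process t w)).1 in
  {ae PV, forall w, Xs (time0 R) w = xs0} /\
  markov_process PV Xs Q.
Proof.
move=> Xs.
have mXs t : measurable_fun setT (Xs t : _ -> borel Ds).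
  apply: (measurableT_comp (@measurable_link_base _ _ _ lambda)).
  move=> _ B mB; rewrite setTI; apply: sub_sigma_algebra.
  by exists t, B.
have fddXs N t (A : nat -> set (borel Ds)) : time_grid N t ->
    (forall i, measurable (A i)) ->
    PV (cylinder Xs N t A) = fdd Q t A N 0 xs0.
  move=> [N0 t0 t01 tS] mA.
  rewrite -(link_integral_fdd V_linked)//; last first.
    by move=> [//|j] /andP[_ jN]; apply/ltW/tS.
  rewrite -PV_fdd// => i.
  by rewrite -[X in measurable X]setTI; exact: measurable_link_base.
split; last exact: (markov_of_fdd mXs Q_semigroup.1 fddXs).
apply: (initial_state_of_fdd mXs Q_semigroup.1 fddXs).
exact: polish_space_measurable1 Ds_polish.
Qed.
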